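(* Let $K$ be a field, $S=K[x_1,\ldots,x_n]$, and let $I=P_{F_1}\cdots P_{F_r}\subset S$ be a transversal polymatroidal ideal. Then $$\operatorname{Ass}(I)=\{P_{\mathcal T} : \mathcal T \text{ is a tree in } G_I\}.$$
   Context: For a non-empty subset $F\subset[n]=\{1,\ldots,n\}$, $P_F=(x_i : i\in F)$. A transversal polymatroidal ideal is an ideal of the form $I=P_{F_1}\cdots P_{F_r}$, where $r\ge1$ and $F_1,\ldots,F_r$ is a collection of non-empty, not necessarily distinct, subsets of $[n]$. $G_I$ is the graph with vertex set $\{1,\ldots,r\}$ in which, for $i\ne j$, $\{i,j\}$ is an edge if and only if $F_i\cap F_j\neq\emptyset$. A tree in $G_I$ is a (non-empty, not necessarily induced or spanning) subgraph of $G_I$ that is a tree; single vertices count as trees. For a subgraph $\mathcal H$ of $G_I$ with vertex set $\mathcal V(\mathcal H)$, $P_{\mathcal H}=\sum_{i\in\mathcal V(\mathcal H)}P_{F_i}$. $\operatorname{Ass}(I)$ denotes the set of associated prime ideals of $S/I$. *)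

(* Defs.v *)
From mathcomp Require Export all_boot all_order all_algebra.
From mathcomp Require Export boolp classical_sets.
From mathcomp Require Export mpoly.

Set Implicit Arguments.
Unset Strict Implicit.
Unset Printing Implicit Defensive.

Import GRing.Theory.

Local Open Scope ring_scope.
Local Open Scope classical_set_scope.

Section Ideals.
Variable R : comNzRingType.
Implicit Types I J P : set R.

(* The library's [idealr_closed] only describes proper ideals. *)
Definition is_ideal I : Prop := GRing.submod_closed (V := R^o) (mem I).

Definition is_prime_ideal P : Prop :=
  idealr_closed (mem P) /\ prime_idealr_closed (mem P).

Definition ideal_gen (G : set R) : set R := smallest is_ideal G.

Definition ideal_mul I J : set R :=
  ideal_gen [set a * b | a in I & b in J].

Definition ideal_add I J : set R := [set a + b | a in I & b in J].

(* The annihilator in R of the class of f in R / I. *)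
Definition ann_quot I (f : R) : set R := [set g | I (g * f)].

Definition Ass I : set (set R) :=
  [set P | is_prime_ideal P /\ exists f : R, P = ann_quot I f].

End Ideals.

Section Graphs.
Variables (T : finType) (G : rel T).

Record subgraph := Subgraph {
  vertices : {set T};
  edge : rel T;
  edge_sym : ssrbool.symmetric edge;
  edge_vertices : forall i j, edge i j -> (i \in vertices) && (j \in vertices);
  edge_sub : subrel edge G }.

Definition is_connected (H : subgraph) : Prop :=
  {in vertices H &, forall i j, connect (edge H) i j}.

(* A traversal i, j of an edge back and forth is a [ucycle] of size 2, so the
   cycles of a simple graph are the [ucycle]s of size at least 3. *)
Definition is_acyclic (H : subgraph) : Prop :=
  forall c : seq T, ucycle (edge H) c -> (size c < 3)%N.

Definition is_tree (H : subgraph) : Prop :=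
  [/\ vertices H != finset.set0, is_connected H & is_acyclic H].

End Graphs.

Section Transversal.
Variables (K : fieldType) (n : nat).

Definition PF (F : {set 'I_n}) : set {mpoly K[n]} :=
  ideal_gen [set ('X_i : {mpoly K[n]}) | i in [set` F]].

Variables (r : nat) (F : 'I_r -> {set 'I_n}).

Definition transversal_ideal : set {mpoly K[n]} :=
  \big[@ideal_mul {mpoly K[n]} / setT]_(i < r) PF (F i).

Definition transversal_graph : rel 'I_r :=
  fun i j => (i != j) && (F i :&: F j != finset.set0).

Definition PH (H : subgraph transversal_graph) : set {mpoly K[n]} :=
  \big[@ideal_add {mpoly K[n]} / [set 0]]_(i in vertices H) PF (F i).

End Transversal.

Arguments PF K {n} F.
Arguments transversal_ideal K {n r} F.
Arguments PH K {n r F} H.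

(* Main.v *)
(** A monomial x^u lies in I exactly when (F_1, ..., F_r) has a transversal using
    each x_j at most u_j times. By Hall's theorem this means that u has degree at
    least |A| in the variables of F_A, the union of the F_i with i in A, for
    every A; and it suffices to ask this for the A that induce a connected
    subgraph of G_I, because the F_A of distinct components are disjoint. Hence I
    is the intersection of the P_{F_A}-primary ideals P_{F_A}^|A| over connected
    A, so each associated prime of I is one of these P_{F_A}.

    Conversely, for A connected, choose a variable in F_i :&: F_j for each edge
    {i, j} of a spanning tree. The product of these |A| - 1 variables is not in
    the product of the P_{F_i}, i in A, but lands in it after multiplication by
    any variable of F_A, as one sees by rooting the tree. Once A has been enlarged
    to contain every i with F_i included in F_A, multiply in addition by a
    variable outside F_A from each remaining F_i: I : f = P_{F_A} for the resulting f. *)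
Require Import Defs.
From mathcomp Require Import fintype finset zify.

Set Implicit Arguments.
Unset Strict Implicit.
Unset Printing Implicit Defensive.

Import GRing.Theory.

(** * Hall's condition and connected index sets *)

Section Joined.
Variables (I T : finType) (F : I -> {set T}).
Implicit Types (V A B : {set I}) (u : T -> nat).

Definition nbh A : {set T} := \bigcup_(i in A) F i.

Lemma nbhU A B : nbh (A :|: B) = nbh A :|: nbh B.
Proof. exact: bigcup_setU. Qed.

Lemma nbh1 i : nbh [set i] = F i.
Proof. exact: big_set1. Qed.

Lemma nbhS A B : A \subset B -> nbh A \subset nbh B.
Proof.
move=> AB; apply/bigcupsP => i iA; apply: bigcup_sup; exact: (subsetP AB) iA.
Qed.

(* The vertex sets of the connected subgraphs of the intersection graph of F,
   grown one leaf at a time. *)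
Inductive joined : {set I} -> Prop :=
| joined1 i : joined [set i]
| joinedU V i : joined V -> i \notin V -> F i :&: nbh V != set0 ->
    joined (i |: V).

Lemma joined_neq0 V : joined V -> exists i, i \in V.
Proof. by case=> [i|{}V i _ _ _]; exists i; rewrite ?setU11 ?set11. Qed.

Lemma max_set (P : {set I} -> Prop) A :
  P A -> exists2 B, P B & forall C, P C -> #|C| <= #|B|.
Proof.
move=> /asboolP PA.
case: (@arg_maxnP _ A (fun B => `[< P B >]) (fun B => #|B|) PA) => B.
by move=> /asboolP PB maxB; exists B => // C /asboolP; apply: maxB.
Qed.

(** Take [W] largest among the connected sets with the same union. A missing [F i] inside that union
    is non-empty, so it meets it and [i] could be attached. *)
Lemma joined_saturate V : (forall i, F i != set0) -> joined V ->
  exists2 W, joined W & nbh W = nbh V /\ forall i, F i \subset nbh V -> i \in W.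
Proof.
move=> F0 jV.
have [|W [jW nW] maxW] := @max_set (fun W => joined W /\ nbh W = nbh V) V => //.
exists W => //; split=> // i FiV; apply/negPn/negP => iW.
suff /maxW: joined (i |: W) /\ nbh (i |: W) = nbh V by rewrite cardsU1 iW ltnn.
split; last by rewrite nbhU nbh1 nW; apply/setUidPr.
by apply: joinedU => //; rewrite nW (setIidPl FiV).
Qed.

Section Weight.
Variable u : T -> nat.

Definition wt (X : {set T}) := \sum_(x in X) u x.

Lemma wt_UI (X Y : {set T}) : wt (X :|: Y) + wt (X :&: Y) = wt X + wt Y.
Proof.
rewrite /wt (big_setID Y) /= setIUl setIid (setUidPr (subsetIr _ _)) setDUl.
rewrite setDv setU0 [\sum_(x in X) _](big_setID Y) /=; lia.
Qed.

Lemma wtS (X Y : {set T}) : X \subset Y -> wt X <= wt Y.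
Proof.
by move=> XY; rewrite /wt [leqRHS](big_setID X) /= (setIidPr XY) leq_addr.
Qed.

(** Induction on [#|A|]: a largest connected [W] inside [A] is a component, so its union is disjoint
    from that of [A :\: W] and the weights add up. *)
Lemma hall_joined : (forall V, joined V -> #|V| <= wt (nbh V)) ->
  forall A, #|A| <= wt (nbh A).
Proof.
move=> hall A; have [k] := ubnP #|A|; elim: k A => // k IH A ltAk.
have [->|[i iA]] := set_0Vmem A; first by rewrite cards0.
have [|W [jW sWA] maxW] := @max_set (fun W => joined W /\ W \subset A) [set i].
  by rewrite sub1set; split=> //; apply: joined1.
have disj : nbh W :&: nbh (A :\: W) = set0.
  apply/eqP/negPn/negP => /set0Pn[x /setIP[xW /bigcupP[j /setDP[jA jNW] xj]]].
  have /maxW: joined (j |: W) /\ j |: W \subset A.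
    split; last by rewrite subUset sub1set jA.
    by apply: joinedU => //; apply/set0Pn; exists x; rewrite inE xj.
  by rewrite cardsU1 jNW ltnn.
have EA : A = W :|: (A :\: W) by rewrite -{1}(setIidPr sWA) setID.
have := wt_UI (nbh W) (nbh (A :\: W)).
rewrite -nbhU -EA disj [wt set0]big_set0 addn0 => ->.
rewrite -(cardsID W A) (setIidPr sWA); apply: leq_add; [exact: hall|apply: IH].
have /joined_neq0[j jW'] := jW.
have W0 : 0 < #|W| by apply/card_gt0P; exists j.
have := cardsID W A; rewrite (setIidPr sWA); move: ltAk W0; lia.
Qed.

End Weight.
End Joined.

(** * Hall's marriage theorem with multiplicities *)

Section Hall.
Variables (I T : finType) (u : T -> nat).
Implicit Types (F : I -> {set T}).

Definition hall F := forall A : {set I}, #|A| <= wt u (nbh F A).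

Definition drop_at F i a : I -> {set T} :=
  fun k => if k == i then F i :\ a else F k.

(* Rado's argument: if both deletions violated the condition, at index sets A and
   B, submodularity would violate it for F at A :|: B or (A :&: B) :\ i. *)
Lemma hall_drop F i a b : hall F -> a != b ->
  hall (drop_at F i a) \/ hall (drop_at F i b).
Proof.
move=> hF ab; apply: contrapT => /not_orP[/existsNP[A hA] /existsNP[B hB]].
(* A violating index set contains [i], as deletion changes only [F i]. *)
have in_bad c (C : {set I}) : ~ #|C| <= wt u (nbh (drop_at F i c) C) -> i \in C.
  move=> hC; apply/negPn/negP => iC; apply: hC.
  suff -> : nbh (drop_at F i c) C = nbh F C by [].
  by apply: eq_bigr => k kC; rewrite /drop_at; case: eqP kC iC => // -> ->.
have iA := in_bad _ _ hA; have iB := in_bad _ _ hB.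
move: hA hB; set X := nbh _ A; set Y := nbh _ B => hA hB.
(* Since [a] and [b] differ, a point of [F i] survives at least one deletion. *)
have sU : nbh F (A :|: B) \subset X :|: Y.
  apply/bigcupsP => k; rewrite inE => kAB; apply/subsetP => x xk; rewrite inE.
  have [Ek|Nk] := eqVneq k i; last first.
    have inn c (C : {set I}) : k \in C -> x \in nbh (drop_at F i c) C.
      by move=> kC; apply/bigcupP; exists k => //; rewrite /drop_at (negbTE Nk).
    by case/orP: kAB => /inn ->; rewrite ?orbT.
  have inn c (C : {set I}) : i \in C -> x != c -> x \in nbh (drop_at F i c) C.
    move=> iC xc; apply/bigcupP; exists i => //.
    by rewrite /drop_at eqxx !inE xc -Ek.
  have [Ea|xa] := eqVneq x a; last by rewrite inn.
  by rewrite [x \in Y]inn ?orbT // Ea.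
have sI : nbh F ((A :&: B) :\ i) \subset X :&: Y.
  apply/bigcupsP => k; rewrite !inE => /and3P[Nk kA kB].
  apply/subsetP => x xk; rewrite inE.
  by apply/andP; split; apply/bigcupP; exists k; rewrite // /drop_at (negbTE Nk).
(* The two unions bound [#|A| + #|B| - 1] by [wt u X + wt u Y], which is at most
   [#|A| + #|B| - 2]. *)
have := leq_trans (hF _) (wtS u sU); have := leq_trans (hF _) (wtS u sI).
have := wt_UI u X Y; have := cardsUI A B; have := cardsD1 i (A :&: B).
rewrite inE iA iB /=; move: hA hB; lia.
Qed.

(** Delete points, keeping Hall's condition, until every [F i] is a singleton. The choice is then
    forced, and the condition on the fibre over [x] is the required bound. *)
Theorem hall_marriage F : hall F ->
  exists f : I -> T, (forall i, f i \in F i) /\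
    forall x, #|[set i | f i == x]| <= u x.
Proof.
have [k] := ubnP (\sum_i #|F i|); elim: k F => // k IH F ltk hF.
have [|] := boolP [exists i, 1 < #|F i|].
  case/existsP => i /card_gt1P[a [b [aF bF ab]]].
  have step c : c \in F i -> hall (drop_at F i c) ->
      exists f : I -> T, (forall i, f i \in F i) /\
        forall x, #|[set i | f i == x]| <= u x.
    move=> cF /IH[|f [fF fu]].
      rewrite -ltnS; apply: leq_trans ltk.
      rewrite ltnS (bigD1 i) //= [X in _ <= X](bigD1 i) //= /drop_at eqxx.
      rewrite (cardsD1 c (F i)) cF -addSn leq_add2l.
      by apply: leq_sum => j /negbTE ->.
    exists f; split=> // j; have := fF j; rewrite /drop_at.
    by case: eqP => // ->; case/setD1P.
  by case: (hall_drop i hF ab); apply: step.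
rewrite negb_exists => /forallP small.
have /fin_all_exists[f fF] i : exists x, x \in F i.
  apply/set0Pn; apply/eqP => Fi0.
  by have := hF [set i]; rewrite nbh1 Fi0 cards1 /wt big_set0.
exists f; split=> // x; set A := [set _ | _].
apply: leq_trans (hF A) _; apply: leq_trans (@wtS _ u _ [set x] _) _.
  apply/bigcupsP => i; rewrite inE => /eqP fix_; apply/subsetP => y yF.
  rewrite inE; have := small i; rewrite -leqNgt => /card_le1_eqP H.
  by rewrite (H (f i) y (fF i) yF) fix_.
by rewrite /wt big_set1.
Qed.

End Hall.

(** * Connected index sets as vertex sets of trees *)

Section Trees.
Variables (n r : nat) (F : 'I_r -> {set 'I_n}).
Local Notation G := (transversal_graph F).

(** A largest joined subset of the vertices is closed under the edges of [H], so by connectedness it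
    is everything. *)
Lemma connected_joined (H : subgraph G) :
  vertices H != set0 -> is_connected H -> joined F (vertices H).
Proof.
case/set0Pn => i iV conn.
have [|W [jW sWV] maxW] :=
    @max_set _ (fun W => joined F W /\ W \subset vertices H) [set i].
  by rewrite sub1set; split=> //; apply: joined1.
suff VW : vertices H \subset W.
  by rewrite (_ : vertices H = W) //; apply/eqP; rewrite eqEsubset VW.
have [x xW] := joined_neq0 jW.
have out y z : edge H y z -> y \in W -> z \in W.
  move=> yz yW; apply/negPn/negP => zW.
  suff /maxW: joined F (z |: W) /\ z |: W \subset vertices H.
    by rewrite cardsU1 zW ltnn.
  split; last first.
    by rewrite subUset sWV sub1set; case/andP: (edge_vertices yz) => _ ->.
  apply: joinedU => //; case/andP: (edge_sub yz) => _ /set0Pn[t /setIP[ty tz]].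
  by apply/set0Pn; exists t; rewrite inE tz; apply/bigcupP; exists y.
apply/subsetP => y yV.
rewrite -(@closed_connect _ (edge H) (mem W) _ x y) //; last first.
  by apply: conn => //; apply: (subsetP sWV).
move=> a b ab; apply/idP/idP; first exact: out ab.
by apply: out; rewrite edge_sym.
Qed.

Section AddLeaf.
Variables (H : subgraph G) (i j : 'I_r).
Hypotheses (iV : i \notin vertices H) (jV : j \in vertices H).
Hypothesis ij : F i :&: F j != set0.

Definition leaf_edge : rel 'I_r := fun x y =>
  [|| edge H x y, (x == i) && (y == j) | (x == j) && (y == i)].

Lemma leaf_edge_sym : ssrbool.symmetric leaf_edge.
Proof.
move=> x y; rewrite /leaf_edge edge_sym; congr orb; rewrite [RHS]orbC.
by congr orb; apply: andbC.
Qed.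

Lemma leaf_edge_vertices x y : leaf_edge x y ->
  (x \in i |: vertices H) && (y \in i |: vertices H).
Proof.
case/or3P => [/edge_vertices/andP[xV yV]||]; rewrite !inE.
- by rewrite xV yV !orbT.
- by case/andP => /eqP-> /eqP->; rewrite eqxx jV !orbT.
- by case/andP => /eqP-> /eqP->; rewrite eqxx jV !orbT.
Qed.

Lemma leaf_edge_sub : subrel leaf_edge G.
Proof.
have Nij : i != j by apply: contraNneq iV => ->.
move=> x y /or3P[/edge_sub //||] /andP[/eqP-> /eqP->];
  rewrite /transversal_graph.
  by rewrite Nij.
by rewrite eq_sym Nij setIC.
Qed.

Definition add_leaf : subgraph G :=
  Subgraph leaf_edge_sym leaf_edge_vertices leaf_edge_sub.

Lemma leaf_edgeE x : leaf_edge i x -> x = j.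
Proof.
case/or3P => [/edge_vertices/andP[]||/andP[/eqP ij' /eqP ->]].
- by rewrite (negbTE iV).
- by case/andP => _ /eqP.
- by [].
Qed.

(** A cycle avoiding [i] lies in [H]. In a longer one through [i], both neighbours of [i] would be
    [j], against the distinctness of its entries. *)
Lemma add_leaf_tree : is_tree H -> is_tree add_leaf.
Proof.
case=> _ conn acyc; split.
- by apply/set0Pn; exists i; rewrite setU11.
- have toj x : x \in i |: vertices H -> connect leaf_edge x j.
    case/setU1P => [->|xV].
      by apply: connect1; rewrite /leaf_edge !eqxx orbT.
    apply: connect_sub (conn _ _ xV jV) => a b ab.
    by apply: connect1; rewrite /leaf_edge ab.
  move=> x y xV yV; apply: connect_trans (toj _ xV) _.
  by rewrite (sym_connect_sym leaf_edge_sym) toj.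
- move=> c /andP[cyc uniq_c]; rewrite ltnNge; apply/negP => c3.
  have [ic|iNc] := boolP (i \in c); last first.
    suff /acyc : ucycle (edge H) c by rewrite ltnNge c3.
    rewrite /ucycle uniq_c andbT.
    apply: (sub_in_cycle (P := predC1 i)) cyc.
      move=> x y; rewrite !inE => /negbTE xi /negbTE yi.
      by rewrite /= /leaf_edge xi yi /= andbF orbF.
    by apply/allP => x xc; apply: contraNneq iNc => <-.
  have [k d Ed] := rot_to ic.
  move: cyc uniq_c c3; rewrite -(rot_cycle k) -(rot_uniq k) -(size_rot k c) Ed.
  case: d {Ed} => [|y [|z d]] //= /andP[/leaf_edgeE -> /andP[_]].
  rewrite rcons_path => /andP[_]; rewrite leaf_edge_sym => /leaf_edgeE Ej.
  by rewrite -Ej mem_last /= andbF.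
Qed.

End AddLeaf.

Lemma joined_tree V : joined F V ->
  exists2 H : subgraph G, is_tree H & vertices H = V.
Proof.
elim=> [i|{}V i _ [H treeH HV] iV /set0Pn[x /setIP[xi /bigcupP[j jV xj]]]].
  have no_edge_sym : ssrbool.symmetric (fun _ _ : 'I_r => false) by [].
  have no_edge (x y : 'I_r) : false -> (x \in [set i]) && (y \in [set i]) by [].
  have no_edge_sub : subrel (fun _ _ : 'I_r => false) G by [].
  exists (Subgraph no_edge_sym no_edge no_edge_sub) => //.
  split=> /=; first by apply/set0Pn; exists i; rewrite set11.
  - by move=> x y /set1P-> /set1P->.
  - by case=> [|x [|y c]] // /andP[].
have ij : F i :&: F j != set0 by apply/set0Pn; exists x; rewrite inE xi.
rewrite -HV in iV jV.
by exists (add_leaf iV jV ij); [apply: add_leaf_tree|rewrite -HV].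
Qed.
End Trees.

(** * Monomial ideals *)

Local Open Scope ring_scope.
Local Open Scope classical_set_scope.

Lemma is_idealP (R : comNzRingType) (J : set R) :
  is_ideal J <-> J 0 /\ forall a u v, J u -> J v -> J (a * u + v).
Proof.
split=> [[J0 Jl]|[J0 Jl]].
  split=> [|a u v Ju Jv]; first by rewrite in_setE in J0.
  by have := Jl a u v; rewrite !in_setE; apply.
by split=> [|a u v]; rewrite !in_setE //; apply: Jl.
Qed.

Lemma ideal_gen_ideal (R : comNzRingType) (G : set R) : is_ideal (ideal_gen G).
Proof.
apply/is_idealP; split=> [J [/is_idealP[] //]|a u v Gu Gv J HJ].
have /is_idealP[_ Jl] := HJ.1; exact: Jl (Gu J HJ) (Gv J HJ).
Qed.

Lemma ideal_mulr (R : comNzRingType) (J : set R) a u :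
  is_ideal J -> J u -> J (a * u).
Proof. by move=> /is_idealP[J0 Jl] Ju; rewrite -[a * u]addr0; apply: Jl. Qed.

Section Monomial.
Variables (K : fieldType) (n : nat).
Implicit Types (f g : {mpoly K[n]}) (m : 'X_{1..n}) (M : 'X_{1..n} -> Prop).
Implicit Types (A B : {set 'I_n}) (p : pred 'X_{1..n}).

(* An ideal only when M is upclosed. *)
Definition monideal M : set {mpoly K[n]} :=
  [set f | forall m, m \in msupp f -> M m].

Definition upclosed M := forall m m', M m -> M (m + m')%MM.

Lemma monidealD M f g : monideal M f -> monideal M g -> monideal M (f + g).
Proof.
by move=> Mf Mg m /msuppD_le; rewrite mem_cat => /orP[]; [apply: Mf|apply: Mg].
Qed.

Lemma monidealN M f : monideal M f -> monideal M (- f).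
Proof. by move=> Mf m; rewrite (perm_mem (msuppN f)); apply: Mf. Qed.

Lemma monidealM M1 M2 M f g :
  (forall m1 m2, M1 m1 -> M2 m2 -> M (m1 + m2)%MM) ->
  monideal M1 f -> monideal M2 g -> monideal M (f * g).
Proof.
by move=> HM Mf Mg m /msuppM_le/allpairsP[[m1 m2] /= [/Mf ? /Mg ? ->]]; apply: HM.
Qed.

Lemma monideal_ideal M : upclosed M -> is_ideal (monideal M).
Proof.
move=> upM; apply/is_idealP; split=> [m|a u v Mu Mv]; first by rewrite msupp0.
apply: monidealD => //; rewrite mulrC.
by apply: (@monidealM M (fun _ => True)) => // m1 m2 /upM.
Qed.

Lemma monidealX M m : M m -> monideal M 'X_[m].
Proof. by move=> Mm m'; rewrite msuppX inE => /eqP->. Qed.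

Lemma monideal_sub M (J : set {mpoly K[n]}) : is_ideal J ->
  (forall m, M m -> J 'X_[m]) -> monideal M `<=` J.
Proof.
move=> JI MJ f Mf; rewrite (mpolyE f) big_seq.
have /is_idealP[J0 Jl] := JI.
elim/big_rec: _ => // m g mf Jg; rewrite -mul_mpolyC; apply: Jl => //.
by apply: MJ; apply: Mf.
Qed.

Lemma ideal_gen_monideal M (G : set {mpoly K[n]}) : upclosed M ->
  G `<=` monideal M -> (forall m, M m -> ideal_gen G 'X_[m]) ->
  ideal_gen G = monideal M.
Proof.
move=> upM GM MG; apply/seteqP; split.
  by apply: smallest_sub => //; apply: monideal_ideal.
by apply: monideal_sub => //; apply: ideal_gen_ideal.
Qed.

Lemma ideal_mul_monideal M1 M2 : upclosed M2 ->
  ideal_mul (monideal M1) (monideal M2) =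
  monideal (fun m => exists m1 m2, [/\ M1 m1, M2 m2 & m = (m1 + m2)%MM]).
Proof.
move=> up2; apply: ideal_gen_monideal.
- move=> _ m [m1 [m2 [M1m M2m ->]]]; exists m1, (m2 + m)%MM.
  by rewrite addmA; split=> //; apply: up2.
- move=> _ [f Mf [g Mg <-]]; apply: monidealM Mf Mg => m1 m2 Hm1 Hm2.
  by exists m1, m2.
- move=> _ [m1 [m2 [M1m M2m ->]]]; rewrite mpolyXD; apply: sub_gen_smallest.
  by exists 'X_[m1]; [apply: monidealX|exists 'X_[m2]; [apply: monidealX|]].
Qed.

Definition restr p f : {mpoly K[n]} :=
  \sum_(m <- msupp f | p m) f@_m *: 'X_[m].

Lemma restrE p f : f = restr p f + restr (predC p) f.
Proof. by rewrite {1}(mpolyE f) (bigID p). Qed.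

Lemma msupp_restr p f m : m \in msupp (restr p f) -> p m && (m \in msupp f).
Proof.
rewrite /restr big_seq_cond.
elim/big_rec: _ => [|m' g /andP[m'f pm'] IH]; first by rewrite msupp0.
move=> /msuppD_le; rewrite mem_cat => /orP[/msuppZ_le|/IH //].
by rewrite msuppX inE => /eqP->; rewrite pm'.
Qed.

Lemma restr_neq0 p f m : m \in msupp f -> p m -> restr p f != 0.
Proof.
move=> mf pm; apply/eqP => r0; move: mf; rewrite (restrE p f) r0 add0r.
by move=> /msupp_restr; rewrite /= pm.
Qed.

Lemma ideal_add_monideal M1 M2 :
  ideal_add (monideal M1) (monideal M2) = monideal (fun m => M1 m \/ M2 m).
Proof.
apply/seteqP; split=> [_ [f Mf [g Mg <-]]|f Mf].
  by apply: monidealD => m ?; [left; apply: Mf|right; apply: Mg].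
exists (restr (fun m => `[< M1 m >]) f).
  by move=> m /msupp_restr/andP[/asboolP].
exists (restr (predC (fun m => `[< M1 m >])) f); last by rewrite -restrE.
by move=> m /msupp_restr/andP[/= /asboolPn NM1 /Mf[]].
Qed.

(** * Degrees in a set of variables and powers of [PF] *)

Lemma wtD (m1 m2 : 'X_{1..n}) A : wt (m1 + m2)%MM A = (wt m1 A + wt m2 A)%N.
Proof. by rewrite /wt -big_split; apply: eq_bigr => i _; rewrite mnmDE. Qed.

Lemma wt0 A : wt (0%MM : 'X_{1..n}) A = 0%N.
Proof. by rewrite /wt big1 // => i _; rewrite mnm0E. Qed.

Lemma wtU i A : wt (U_(i)%MM : 'X_{1..n}) A = (i \in A).
Proof.
rewrite /wt; have [iA|iNA] := boolP (i \in A).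
  rewrite (bigD1 i) //= mnm1E eqxx big1 // => j /andP[_ /negbTE].
  by rewrite mnm1E eq_sym => ->.
by apply: big1 => j jA; rewrite mnm1E; case: eqP iNA jA => // -> /negbTE ->.
Qed.

Lemma wt_gt0 m A : reflect (exists2 i, i \in A & (U_(i) <= m)%MM) (0 < wt m A)%N.
Proof.
apply: (iffP idP) => [|[i iA im]].
  rewrite lt0n sum_nat_eq0 negb_forall => /existsP[i].
  by rewrite negb_imply => /andP[iA mi]; exists i; rewrite ?lep1mP.
by rewrite -(submK im) wtD wtU iA addn1.
Qed.

(* The k-th power of P_A, which is also its k-th symbolic power. *)
Definition symb A k : set {mpoly K[n]} := monideal (fun m => k <= wt m A)%N.

Lemma symb_ideal A k : is_ideal (symb A k).
Proof. by apply: monideal_ideal => m m' H; rewrite wtD; lia. Qed.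

Lemma symbS A k l f : (l <= k)%N -> symb A k f -> symb A l f.
Proof. by move=> lk Hf m /Hf; apply: leq_trans. Qed.

Lemma symbM A k l f g : symb A k f -> symb A l g -> symb A (k + l) (f * g).
Proof. by apply: monidealM => m1 m2; rewrite wtD; apply: leq_add. Qed.

Lemma symbX A f k : symb A 1 f -> symb A k (f ^+ k).
Proof.
move=> Hf; elim: k => [|k IH] //; rewrite exprS -add1n; exact: symbM.
Qed.

(* Powers of P_A are P_A-primary: the parts of f and g of lowest A-degree have
   a nonzero product. *)
Lemma symb_primary A k f g : symb A k (g * f) -> ~ symb A k f -> symb A 1 g.
Proof.
move=> Hgf Hf m0 m0g; rewrite lt0n; apply/negP => /eqP wm0.
(* [m1] is a monomial of [f] of least degree in [A]; that degree is below [k]. *)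
have [m1 [m1f m1k minf]] : exists m1, [/\ m1 \in msupp f, (wt m1 A < k)%N &
    symb A (wt m1 A) f].
  have /existsNP[m] := Hf; rewrite not_implyE => -[mf /negP].
  rewrite -ltnNge => mk.
  have exd : exists d, has (fun m => wt m A == d) (msupp f).
    by exists (wt m A); apply/hasP; exists m.
  case: (ex_minnP exd) => d /hasP[m1 m1f /eqP <-] min; exists m1.
  have minf : symb A (wt m1 A) f.
    by move=> m' m'f; apply: min; apply/hasP; exists m'.
  by split=> //; apply: leq_ltn_trans (minf _ mf) mk.
set d := wt m1 A in m1k minf.
pose f0 := restr (fun m => wt m A == d) f.
pose g0 := restr (fun m => wt m A == 0%N) g.
have f0N : f0 != 0 by apply: restr_neq0 m1f _ => /=.
have g0N : g0 != 0 by apply: restr_neq0 m0g _; apply/eqP.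
have : symb A d.+1 (g0 * f0).
  pose f' := restr (predC (fun m => wt m A == d)) f.
  pose g' := restr (predC (fun m => wt m A == 0%N)) g.
  have Ef : f = f0 + f' by apply: restrE.
  have Eg : g = g0 + g' by apply: restrE.
  have Hf' : symb A d.+1 f'.
    move=> m /msupp_restr/andP[/= Nd /minf].
    by rewrite leq_eqVlt eq_sym (negbTE Nd).
  have Hg' : symb A 1 g' by move=> m /msupp_restr/andP[/=]; rewrite lt0n.
  (* All other contributions to [g * f] have degree above [d], and so has [g * f] itself because
     [d < k]. *)
  have -> : g0 * f0 = g * f - (g' * f + g0 * f').
    apply/eqP; rewrite eq_sym subr_eq {1}Eg mulrDl {1}Ef mulrDr -addrA.
    by rewrite [g' * f + _]addrC.
  apply: monidealD; first exact: symbS m1k Hgf.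
  apply: monidealN; apply: monidealD; first by rewrite -add1n; apply: symbM.
  exact: (ideal_mulr g0 (symb_ideal A d.+1) Hf').
(* The leading monomial of [g0 * f0] has degree exactly [d], a contradiction. *)
have supp : (mlead g0 + mlead f0)%MM \in msupp (g0 * f0).
  by rewrite -mleadM // mlead_supp // mulf_neq0.
move=> /(_ _ supp); rewrite wtD.
have /andP[/eqP -> _] := msupp_restr (mlead_supp g0N).
by have /andP[/eqP -> _] := msupp_restr (mlead_supp f0N); rewrite ltnn.
Qed.

Lemma PF_symb A : PF K A = symb A 1.
Proof.
apply: ideal_gen_monideal.
- by move=> m m' H; rewrite wtD; lia.
- by move=> _ [i iA <-]; apply: monidealX; rewrite wtU; move: iA => /= ->.
- move=> m /wt_gt0[i iA im]; rewrite -(submK im) mpolyXD.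
  apply: (ideal_mulr _ (ideal_gen_ideal _)).
  by apply: sub_gen_smallest; exists i.
Qed.

(** Primality is [symb_primary] with [k = 1]. *)
Lemma PF_prime A : is_prime_ideal (PF K A).
Proof.
rewrite PF_symb; have /is_idealP[I0 Il] := symb_ideal A 1.
split.
  split; rewrite ?in_setE //.
    apply/negP; rewrite in_setE => /(_ 0%MM).
    by rewrite msupp1 inE eqxx wt0 => /(_ isT).
  by move=> a u v; rewrite !in_setE; apply: Il.
move=> u v; rewrite !in_setE => uv; apply/orP.
have [Hv|Hv] := pselect (symb A 1 v); [right|left]; rewrite in_setE //.
exact: symb_primary uv Hv.
Qed.

Lemma PFU A B : PF K (A :|: B)%SET = ideal_add (PF K A) (PF K B).
Proof.
rewrite !PF_symb /symb ideal_add_monideal; apply: congr1; apply/funext => m.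
apply/propext; split=> [/wt_gt0[i /setUP[iA|iB] im]|].
- by left; apply/wt_gt0; exists i.
- by right; apply/wt_gt0; exists i.
- by case=> /wt_gt0[i iA im]; apply/wt_gt0; exists i => //; rewrite inE iA ?orbT.
Qed.

Lemma PF0 : PF K (finset.set0 : {set 'I_n}) = [set 0].
Proof.
rewrite PF_symb; apply/seteqP; split=> [f Hf|_ ->]; last first.
  by move=> m; rewrite msupp0.
apply/eqP; rewrite -msupp_eq0; case E: (msupp f) => [//|m s].
by have := Hf m; rewrite E mem_head /wt big_set0 => /(_ isT).
Qed.

Lemma PF_bigcup (I : finType) (V : {set I}) (F : I -> {set 'I_n}) :
  PF K (nbh F V) = \big[@ideal_add _/[set 0]]_(i in V) PF K (F i).
Proof. exact: (big_morph (PF K) PFU PF0). Qed.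

End Monomial.

(** * Transversal polymatroidal ideals *)

Section Transversal.
Variables (K : fieldType) (n : nat).
Implicit Types (m u : 'X_{1..n}) (f g : {mpoly K[n]}).

Lemma addmAC : right_commutative (@mnm_add n).
Proof. by move=> a b c; rewrite -!addmA [(b + c)%MM]addmC. Qed.

(** Divisibility of the monomial [m] by a generator of the product ideal, the product of the
    variables [t i]. *)
Definition has_transversal r (F : 'I_r -> {set 'I_n}) m :=
  exists2 t : 'I_r -> 'I_n, forall i, t i \in F i &
    forall x, (\sum_(i < r) (t i == x) <= m x)%N.

Lemma has_transversal_up r (F : 'I_r -> {set 'I_n}) :
  upclosed (has_transversal F).
Proof.
move=> m m' [t tF tm]; exists t => // x; rewrite mnmDE.
exact: leq_trans (tm x) (leq_addr _ _).
Qed.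

Lemma has_transversal_recl r (F : 'I_r.+1 -> {set 'I_n}) m :
  has_transversal F m <-> exists m1 m2, [/\ (0 < wt m1 (F ord0))%N,
    has_transversal (fun i => F (lift ord0 i)) m2 & m = (m1 + m2)%MM].
Proof.
split=> [[t tF tm]|[m1 [m2 [/wt_gt0[x xF xm1] [t tF tm] ->]]]].
  exists U_(t ord0)%MM, (m - U_(t ord0))%MM; split; first by rewrite wtU tF.
    exists (fun i => t (lift ord0 i)) => [i|x]; first exact: tF.
    have := tm x; rewrite big_ord_recl mnmBE mnm1E => tmx.
    by rewrite leq_subRL // (leq_trans _ tmx) ?leq_addr.
  rewrite addmC submK //; apply/mnm_lepP => x.
  by rewrite mnm1E; apply: leq_trans (tm x); rewrite big_ord_recl leq_addr.
(* The default value [x] of [oapp] is the choice for [ord0]. *)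
exists (fun i => oapp t x (unlift ord0 i)) => [i|y].
  by case: unliftP => [j|] ->; rewrite /= ?tF.
rewrite big_ord_recl unlift_none /= mnmDE leq_add //.
  by move/mnm_lepP/(_ y): xm1; rewrite mnm1E.
by under eq_bigr do rewrite liftK /=.
Qed.

Lemma has_transversalP r (F : 'I_r -> {set 'I_n}) m :
  has_transversal F m <-> hall m F.
Proof.
have cardE (t : 'I_r -> 'I_n) x :
    #|[set i | t i == x]%SET| = (\sum_(i < r) (t i == x))%N.
  by rewrite -sum1dep_card big_mkcond /=; apply: eq_bigr => i _; case: eqP.
split=> [[t tF tm] A|/hall_marriage[t [tF tm]]]; last first.
  by exists t => // x; rewrite -cardE.
(* Double counting: each [i] in [A] contributes once, at the point [t i] of the union. *)
apply: leq_trans (leq_sum _ (fun x _ => tm x)); rewrite exchange_big /=.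
rewrite -sum1_card [leqRHS](bigID (mem A)) /=; apply: leq_trans (leq_addr _ _).
apply: leq_sum => i iA; rewrite (bigD1 (t i)) ?eqxx //=.
by apply/bigcupP; exists i.
Qed.

Lemma transversal_idealE r (F : 'I_r -> {set 'I_n}) :
  transversal_ideal K F = monideal (has_transversal F).
Proof.
elim: r F => [|r IH] F.
  (* The empty product is the whole ring, and every monomial has the empty transversal. *)
  rewrite /transversal_ideal big_ord0; apply/seteqP; split=> // f _ m _.
  have t : 'I_0 -> 'I_n by case.
  by exists t => [[]//|x]; rewrite big_ord0.
rewrite /transversal_ideal big_ord_recl.
rewrite -[X in ideal_mul _ X]/(transversal_ideal K (fun i => F (lift ord0 i))).
rewrite IH PF_symb ideal_mul_monideal; last exact: has_transversal_up.
apply: congr1; apply/funext => m; apply/propext.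
by rewrite has_transversal_recl.
Qed.

(** A primary decomposition of the ideal, from Hall's theorem and [hall_joined]. *)
Lemma transversal_ideal_symb r (F : 'I_r -> {set 'I_n}) f :
  transversal_ideal K F f <->
  forall V, joined F V -> symb (nbh F V) #|V| f.
Proof.
rewrite transversal_idealE; split=> [If V _ m /If|If m mf].
  by move=> /has_transversalP; apply.
by apply/has_transversalP; apply: hall_joined => V /If; apply.
Qed.

(** * Connected index sets give associated primes *)

Section Converse.
Variables (r : nat) (F : 'I_r -> {set 'I_n}).
Hypothesis F_neq0 : forall i, F i != finset.set0.

(** [u] collects the edge variables of a spanning tree, one per attached leaf. The last clause is
    Hall's condition inside [V] for [u] times a variable of the union. *)
Lemma joined_witness V : joined F V ->
  exists2 u : 'X_{1..n}, (wt u finset.setT).+1 = #|V| &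
  forall x, x \in nbh F V -> forall A : {set 'I_r}, A \subset V ->
    (#|A| <= wt (u + U_(x))%MM (nbh F A))%N.
Proof.
elim=> [i|{}V i jV [u wu hu] iV /set0Pn[e /setIP[ei eV]]].
  exists 0%MM; first by rewrite wt0 cards1.
  move=> x; rewrite nbh1 => xi A.
  rewrite subset1 => /orP[]/eqP->; last by rewrite cards0.
  by rewrite cards1 nbh1 wtD wtU xi addn1.
exists (u + U_(e))%MM.
  by rewrite cardsU1 iV -wu wtD wtU inE addn1 add1n.
move=> x xV A AV.
have AiV : A :\ i \subset V by rewrite subDset.
(* Here [z] serves the new leaf [i] and [y] completes [u] on [V]. If [x] lies in [F i], it serves
   [i] and [e] goes to [V]; otherwise the roles are exchanged. *)
have step y z : y \in nbh F V -> z \in F i ->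
    (#|A| <= wt (u + U_(y) + U_(z))%MM (nbh F A))%N.
  move=> yV zi; rewrite (cardsD1 i A) addnC wtD; apply: leq_add.
    by apply: leq_trans (hu y yV _ AiV) (wtS _ _); apply: nbhS; apply: subD1set.
  case iA: (i \in A) => //; rewrite wtU.
  by have -> : z \in nbh F A by apply/bigcupP; exists i.
by move: xV; rewrite nbhU nbh1 => /setUP[|] xV; [|rewrite addmAC]; apply: step.
Qed.

Lemma joined_Ass V : joined F V -> Ass (transversal_ideal K F) (PF K (nbh F V)).
Proof.
move=> jV0; split; first exact: PF_prime.
have [W jV [<- satV]] := joined_saturate F_neq0 jV0.
move: W jV satV => {V jV0}V jV satV.
have [u wu hu] := joined_witness jV.
(* Saturation provides [y i] outside the union when [i] is not in [V]; on [V] the value is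
   arbitrary. *)
have /choice[y yP] i : exists x, i \notin V -> x \in F i :\: nbh F V.
  have [iV|iNV] := boolP (i \in V).
    by have /set0Pn[x _] := F_neq0 i; exists x.
  have /set0Pn[x xP] : F i :\: nbh F V != finset.set0.
    by rewrite setD_eq0; apply: contraNN iNV; apply: satV.
  by exists x.
pose v : 'X_{1..n} := (\big[mnm_add/0%MM]_(i in ~: V) U_(y i))%MM.
have wtv A : wt v A = (\sum_(i in ~: V) (y i \in A))%N.
  rewrite /v (big_morph (fun m : 'X_{1..n} => wt m A)
    (fun m1 m2 => wtD m1 m2 A) (wt0 A)).
  by apply: eq_bigr => i _; rewrite wtU.
exists 'X_[u + v]; apply/seteqP; split=> g.
(* Hall's condition for [A] splits: [u] and the variable [x] cover [A :&: V], while [v] covers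
   [A :\: V]. *)
- rewrite PF_symb /ann_quot /= transversal_idealE => Pg m.
  rewrite (perm_mem (msuppMX _ _)).
  case/mapP=> m' /Pg/wt_gt0[x xV xm'] ->; apply/has_transversalP => A.
  rewrite -(submK xm') -(cardsID V A).
  rewrite (_ : _ + _ = (m' - U_(x)) + ((u + U_(x)) + v))%MM; last first.
    by apply/mnmP => z; rewrite !mnmDE; lia.
  rewrite 2!wtD; apply: leq_trans (leq_addl _ _); apply: leq_add.
    apply: leq_trans (hu x xV _ (subsetIr A V)) (wtS _ _).
    by apply: nbhS; apply: subsetIl.
  rewrite wtv -sum1_card [leqRHS](bigID (mem A)) /=.
  apply: leq_trans (leq_addr _ _).
  rewrite (eq_bigl (fun i => (i \in ~: V) && (i \in A))); last first.
    by move=> i; rewrite !inE.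
  apply: leq_sum => i /andP[]; rewrite inE => /yP /setDP[yF _] iA.
  by have -> : y i \in nbh F A by apply/bigcupP; exists i.
(* On the union of [V], [v] has degree 0 and [u] at most [#|V| - 1], so [m] must have positive
   degree. *)
- rewrite /ann_quot /= PF_symb => /transversal_ideal_symb/(_ V jV) Ig m mg.
  have := Ig (m + (u + v))%MM.
  have -> : (m + (u + v))%MM \in msupp (g * 'X_[u + v]).
    by rewrite (perm_mem (msuppMX _ _)) addmC map_f.
  move=> /(_ isT); rewrite !wtD -wu wtv big1 ?addn0 => [|i]; last first.
    by rewrite inE => /yP/setDP[_ /negbTE ->].
  move=> /(leq_ltn_trans (wtS u (subsetT (nbh F V)))).
  by rewrite -[X in (X < _)%N]add0n ltn_add2r.
Qed.
End Converse.

(** Whenever [f] is outside the component of [V], primariness puts [P] inside [PF K (nbh F V)]. If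
    equality always failed, elements [q V] of these primes outside [P] would have a product of
    powers [p] with [p * f] in the ideal, so [p] in [P], against primality. *)
Lemma Ass_joined r (F : 'I_r -> {set 'I_n}) (P : set {mpoly K[n]}) :
  Ass (transversal_ideal K F) P -> exists2 V, joined F V & P = PF K (nbh F V).
Proof.
case=> [[[]]]; rewrite !in_setE => P0 P1 Pl Pprime [f EP]; apply: contrapT => NP.
pose bad V := joined F V /\ ~ symb (nbh F V) #|V| f.
have /choice[q qP] V : exists g, bad V -> symb (nbh F V) 1 g /\ ~ P g.
  have [[jV fV]|] := pselect (bad V); last by exists 0.
  apply: contrapT => /forallNP Nq; apply: NP; exists V => //.
  rewrite PF_symb; apply/seteqP; split=> g Hg.
    move: Hg; rewrite EP => /transversal_ideal_symb/(_ V jV) gf.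
    exact: symb_primary gf fV.
  by apply: contrapT => NPg; apply: (Nq g).
pose p := \prod_(V | `[< bad V >]) q V ^+ #|V|.
have : P p.
  rewrite EP; apply/transversal_ideal_symb => V jV.
  have [fV|fV] := pselect (symb (nbh F V) #|V| f).
    by apply: (ideal_mulr _ (symb_ideal _ _ _)).
  (* Here [f] is outside the component, and the factor [q V ^+ #|V|] of [p] brings the product into
     it. *)
  have badV : bad V by [].
  rewrite /p (bigD1 V) /=; last exact/asboolP.
  rewrite mulrAC mulrC; apply: (ideal_mulr _ (symb_ideal _ _ _)).
  rewrite mulrC; apply: (ideal_mulr _ (symb_ideal _ _ _)).
  by apply: symbX; case: (qP V badV).
have prime_or a b : P (a * b) -> P a \/ P b.
  move=> Pab; have := Pprime a b; rewrite !in_setE => /(_ Pab).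
  by case/orP; rewrite in_setE; [left|right].
have N1 : ~ P 1 by move=> H; case/negP: P1; rewrite in_setE.
rewrite /p; elim/big_rec: _ => // V g /asboolP /qP[_ NPq] Ng /prime_or[|//].
by elim: #|V| => [|k IH]; rewrite ?expr0 // exprS => /prime_or[].
Qed.

End Transversal.

Theorem theorem3p7 (K : fieldType) (n r : nat) (F : 'I_r -> {set 'I_n})
    (r_gt0 : (0 < r)%N) (F_neq0 : forall i : 'I_r, F i != finset.set0) :
  Ass (transversal_ideal K F) =
  [set PH K T | T in [set T : subgraph (transversal_graph F) | is_tree T]].
Proof.
apply/seteqP; split=> P.
  move=> /Ass_joined[V jV ->]; have [T treeT <-] := joined_tree jV.
  by exists T; rewrite // /PH PF_bigcup.
move=> [T [V0 connT _] <-]; rewrite /PH -PF_bigcup.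
by apply: joined_Ass => //; apply: connected_joined.
Qed.
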